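(* Let $G$ be a finite group and $\Gamma\subset G$ a union of conjugacy classes. Suppose $u\in\mathcal H_{G,\Gamma}$ has $ev(u)\in G$ of order $\ell$ and $\mathcal S=\{u^{n\ell}\mid n\ge0\}$ is such that the monoid of fractions $\mathcal H_{G,\Gamma}\mathcal S^{-1}$ is a group. Then for $v,w\in\Gamma^d$: $$v,w\text{ are }u\text{-stably equivalent}\quad\iff\quad e_{v_1}\cdots e_{v_d}=e_{w_1}\cdots e_{w_d}\in\operatorname{Adj}\Gamma.$$
   Context: The braid group $\mathrm{Br}_d$ acts on $G^d$ by the Hurwitz action, in which the standard generators act by $(\dots,v_i,v_{i+1},\dots)\mapsto(\dots,v_{i+1},v_{i+1}^{-1}v_iv_{i+1},\dots)$; this preserves $\Gamma^d$. Write $v\approx w$ (braid equivalent) if $v,w$ lie in the same braid orbit. $\mathcal H_{G,\Gamma}=\coprod_{d\ge0}\Gamma^d/\mathrm{Br}_d$ is the monoid with product induced by juxtaposition of tuples (unit the empty tuple). The evaluation $ev(v_1,\dots,v_d)=v_1\cdots v_d\in G$ is constant on braid orbits and induces a monoid homomorphism $ev:\mathcal H_{G,\Gamma}\to G$. Elements $u$ with $ev(u)=1$ are central in $\mathcal H_{G,\Gamma}$. Elements $v,w$ are $u$-stably equivalent if $vu^k\approx wu^k$ for some $k$. For $\mathcal S$ as in the claim (a central submonoid), $\mathcal H_{G,\Gamma}\mathcal S^{-1}$ is the monoid of fractions $[x/s]_u$, $x\in\mathcal H_{G,\Gamma}$, $s\in\mathcal S$, where $[x/s]_u=[x'/s']_u$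 iff there are $\tilde r\in\mathcal H_{G,\Gamma}$, $\tilde s\in\mathcal S$ with $x\tilde r=x'\tilde s$, $s\tilde r=s'\tilde s$, with product $[x/s]_u[y/t]_u=[xy/st]_u$. With $a^b=b^{-1}ab$, $\operatorname{Adj}\Gamma=\langle e_g,\ g\in\Gamma\mid e_ae_b=e_be_{a^b},\ a,b\in\Gamma\rangle$. *)

(* Defs.v *)
From HB Require Import structures.
From mathcomp Require Import all_boot all_fingroup.
From mathcomp Require Import boolp.

Set Warnings "-redundant-canonical-projection".

Set Implicit Arguments.
Unset Strict Implicit.
Unset Printing Implicit Defensive.

Local Open Scope group_scope.
Local Open Scope quotient_scope.

Section Presentation.
Variable X : choiceType.

(* The letter (x, false) stands for x and (x, true) for x^-1. *)
Definition gword := seq (X * bool).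

Definition gword_inv (w : gword) : gword := rev [seq (l.1, ~~ l.2) | l <- w].

Variable R : gword -> gword -> Prop.

Inductive pres_cong : gword -> gword -> Prop :=
| pres_refl w : pres_cong w w
| pres_sym w1 w2 : pres_cong w1 w2 -> pres_cong w2 w1
| pres_trans w1 w2 w3 : pres_cong w1 w2 -> pres_cong w2 w3 -> pres_cong w1 w3
| pres_cancel w1 w2 x b :
    pres_cong (w1 ++ [:: (x, b); (x, ~~ b)] ++ w2) (w1 ++ w2)
| pres_rel w1 w2 r s : R r s -> pres_cong (w1 ++ r ++ w2) (w1 ++ s ++ w2).

Lemma pres_congl z w1 w2 : pres_cong w1 w2 -> pres_cong (z ++ w1) (z ++ w2).
Proof.
elim=> {w1 w2} [w|w1 w2 _|w1 w2 w3 _ h1 _|w1 w2 x b|w1 w2 r s Rrs].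
- exact: pres_refl.
- exact: pres_sym.
- exact: pres_trans.
- by rewrite !(catA z); apply: pres_cancel.
- by rewrite !(catA z); apply: pres_rel.
Qed.

Lemma pres_congr z w1 w2 : pres_cong w1 w2 -> pres_cong (w1 ++ z) (w2 ++ z).
Proof.
elim=> {w1 w2} [w|w1 w2 _|w1 w2 w3 _ h1 _|w1 w2 x b|w1 w2 r s Rrs].
- exact: pres_refl.
- exact: pres_sym.
- exact: pres_trans.
- by rewrite -!catA; apply: pres_cancel.
- by rewrite -!catA; apply: pres_rel.
Qed.

Lemma gword_invK : involutive gword_inv.
Proof.
move=> w; rewrite /gword_inv map_rev revK -map_comp -[RHS]map_id.
by apply: eq_map => -[x b] /=; rewrite negbK.
Qed.

Lemma pres_congV w : pres_cong (w ++ gword_inv w) [::].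
Proof.
elim: w => [|[x b] w IHw]; first exact: pres_refl.
rewrite /gword_inv /= rev_cons -cats1.
have := pres_congl [:: (x, b)] (pres_congr [:: (x, ~~ b)] IHw).
by rewrite -catA => /pres_trans; apply; apply: (pres_cancel [::] [::]).
Qed.

Definition pres_eq (w1 w2 : gword) : bool := `[< pres_cong w1 w2 >].

Lemma pres_eq_refl : reflexive pres_eq.
Proof. by move=> w; apply/asboolP; apply: pres_refl. Qed.
Lemma pres_eq_sym : symmetric pres_eq.
Proof. by move=> w1 w2; apply/asboolP/asboolP; apply: pres_sym. Qed.
Lemma pres_eq_trans : transitive pres_eq.
Proof.
by move=> w2 w1 w3 /asboolP h1 /asboolP h2; apply/asboolP/(pres_trans h1 h2).
Qed.

Canonical pres_equiv := EquivRel pres_eq pres_eq_refl pres_eq_sym pres_eq_trans.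

Definition presented_group := {eq_quot pres_equiv}.

HB.instance Definition _ := Choice.on presented_group.

Definition pres_class (w : gword) : presented_group :=
  \pi_({eq_quot pres_equiv}) w.

Lemma pres_classP w1 w2 : pres_class w1 = pres_class w2 <-> pres_cong w1 w2.
Proof. by split=> [/eqmodP/asboolP | h]; last by apply/eqmodP/asboolP. Qed.

Definition pres_repr (g : presented_group) : gword := generic_quotient.repr (g : {eq_quot pres_equiv}).

Lemma pres_reprK : cancel pres_repr pres_class.
Proof. by move=> g; rewrite /pres_class reprK. Qed.

Lemma pres_reprP w : pres_cong (pres_repr (pres_class w)) w.
Proof. by apply/pres_classP; rewrite pres_reprK. Qed.

Definition pres_mul g h := pres_class (pres_repr g ++ pres_repr h).
Definition pres_inv g := pres_class (gword_inv (pres_repr g)).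
Definition pres_one := pres_class [::].

Lemma pres_mulE w1 w2 :
  pres_mul (pres_class w1) (pres_class w2) = pres_class (w1 ++ w2).
Proof.
apply/pres_classP; apply: (@pres_trans _ (w1 ++ pres_repr (pres_class w2))).
  exact/pres_congr/pres_reprP.
exact/pres_congl/pres_reprP.
Qed.

Lemma pres_mulA : associative pres_mul.
Proof.
move=> f g h; rewrite -(pres_reprK f) -(pres_reprK g) -(pres_reprK h).
by rewrite !pres_mulE catA.
Qed.
Lemma pres_mul1 : left_id pres_one pres_mul.
Proof. by move=> g; rewrite -(pres_reprK g) pres_mulE. Qed.
Lemma pres_mulr1 : right_id pres_one pres_mul.
Proof. by move=> g; rewrite -(pres_reprK g) pres_mulE cats0. Qed.
Lemma pres_mulV : right_inverse pres_one pres_inv pres_mul.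
Proof.
move=> g; rewrite -{1}(pres_reprK g) pres_mulE.
exact/pres_classP/pres_congV.
Qed.
Lemma pres_mulVl : left_inverse pres_one pres_inv pres_mul.
Proof.
move=> g; rewrite -{2}(pres_reprK g) pres_mulE; apply/pres_classP.
by rewrite -{2}(gword_invK (pres_repr g)); apply: pres_congV.
Qed.

HB.instance Definition _ := isGroup.Build presented_group
  pres_mulA pres_mul1 pres_mulr1 pres_mulVl pres_mulV.

Definition pres_gen (x : X) : presented_group := pres_class [:: (x, false)].

Lemma pres_classM w1 w2 :
  pres_class (w1 ++ w2) = pres_class w1 * pres_class w2.
Proof. by rewrite -pres_mulE. Qed.

Section Lift.
Variables (H : groupType) (f : X -> H).

Definition gword_eval (w : gword) : H :=
  \prod_(l <- w) (if l.2 then (f l.1)^-1 else f l.1).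

Definition pres_lift (g : presented_group) : H := gword_eval (pres_repr g).

Hypothesis fR : forall r s, R r s -> gword_eval r = gword_eval s.

Lemma gword_eval_cat w1 w2 :
  gword_eval (w1 ++ w2) = gword_eval w1 * gword_eval w2.
Proof. by rewrite /gword_eval big_cat. Qed.

Lemma gword_eval_cong w1 w2 : pres_cong w1 w2 -> gword_eval w1 = gword_eval w2.
Proof.
elim=> {w1 w2} [w|w1 w2 _|w1 w2 w3 _ h1 _|w1 w2 x b|w1 w2 r s Rrs] //.
- by rewrite h1.
- rewrite !gword_eval_cat; congr (_ * _).
  rewrite -[RHS]mul1g; congr (_ * _).
  by rewrite /gword_eval !big_cons big_nil /= mulg1; case: b; rewrite (mulgV, mulVg).
- by rewrite !gword_eval_cat (fR Rrs).
Qed.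

Lemma pres_lift_class w : pres_lift (pres_class w) = gword_eval w.
Proof. exact/gword_eval_cong/pres_reprP. Qed.

Lemma pres_lift_gen x : pres_lift (pres_gen x) = f x.
Proof. by rewrite pres_lift_class /gword_eval big_seq1. Qed.

Lemma pres_liftM : {morph pres_lift : g h / g * h}.
Proof.
move=> g h; rewrite -(pres_reprK g) -(pres_reprK h) -pres_classM.
by rewrite !pres_lift_class gword_eval_cat.
Qed.

End Lift.

End Presentation.

(* The generator sigma_i, for i : 'I_d.-1, braids the strands i and i + 1;
   Br_0 and Br_1 are trivial. *)
Inductive braid_rel (d : nat) : gword 'I_d.-1 -> gword 'I_d.-1 -> Prop :=
| braid_rel_far (i j : 'I_d.-1) : i.+1 < j ->
    braid_rel [:: (i, false); (j, false)] [:: (j, false); (i, false)]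
| braid_rel_near (i j : 'I_d.-1) : i.+1 = j ->
    braid_rel [:: (i, false); (j, false); (i, false)]
              [:: (j, false); (i, false); (j, false)].

Definition braid_group (d : nat) := presented_group (@braid_rel d).
HB.instance Definition _ d := Group.on (braid_group d).

Definition braid_gen d (i : 'I_d.-1) : braid_group d :=
  pres_gen (@braid_rel d) i.

Definition is_class_union (G : finGroupType) (Gamma : {set G}) : Prop :=
  exists2 P : {set {set G}}, P \subset classes [set: G] & Gamma = cover P.

Section Hurwitz.
Variables (G : finGroupType) (Gamma : {set G}).

Definition elt := {g : G | g \in Gamma}.
HB.instance Definition _ := Finite.on elt.

Hypothesis hGamma : is_class_union Gamma.

Lemma class_union_conj a b : a \in Gamma -> a ^ b \in Gamma.
Proof.
case: hGamma => P /subsetP hP ->; rewrite /cover => /bigcupP[C PC aC].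
apply/bigcupP; exists C => //; case/imsetP: (hP _ PC) aC => x _ ->.
by case/imsetP=> y _ ->; rewrite -conjgM memJ_class ?inE.
Qed.

Definition elt_conj (a b : elt) : elt :=
  exist _ (val a ^ val b) (class_union_conj (val b) (valP a)).

Lemma elt_conj_inj b : injective (elt_conj^~ b).
Proof. by move=> a a' /(congr1 val) /= /conjg_inj /val_inj. Qed.

Lemma elt_conjJ a b c :
  elt_conj (elt_conj a b) c = elt_conj (elt_conj a c) (elt_conj b c).
Proof. by apply: val_inj; rewrite /= conjJg. Qed.

Section Action.
Variable d : nat.
Implicit Types (i j : 'I_d.-1) (v : d.-tuple elt).

Lemma strand_lt i : i.+1 < d.
Proof. by case: d i => [|n] [m] //=. Qed.
Definition strand i : 'I_d := Ordinal (ltnW (strand_lt i)).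
Definition strandS i : 'I_d := Ordinal (strand_lt i).

Definition hurwitz_move i v : d.-tuple elt :=
  [tuple if k == strand i then tnth v (strandS i)
         else if k == strandS i
              then elt_conj (tnth v (strand i)) (tnth v (strandS i))
         else tnth v k | k < d].

Lemma strand_neq i : strandS i != strand i.
Proof. by rewrite -val_eqE /= neq_ltn ltnSn orbT. Qed.

Lemma hurwitz_moveL i v : tnth (hurwitz_move i v) (strand i) = tnth v (strandS i).
Proof. by rewrite tnth_mktuple eqxx. Qed.

Lemma hurwitz_moveR i v :
  tnth (hurwitz_move i v) (strandS i)
  = elt_conj (tnth v (strand i)) (tnth v (strandS i)).
Proof. by rewrite tnth_mktuple (negbTE (strand_neq i)) eqxx. Qed.

Lemma hurwitz_move_other i v k :
  k != strand i -> k != strandS i -> tnth (hurwitz_move i v) k = tnth v k.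
Proof. by move=> /negbTE h1 /negbTE h2; rewrite tnth_mktuple h1 h2. Qed.

Lemma hurwitz_move_inj i : injective (hurwitz_move i).
Proof.
move=> v w vw; apply: eq_from_tnth => k.
have E l : tnth (hurwitz_move i v) l = tnth (hurwitz_move i w) l by rewrite vw.
have E1 := E (strand i); rewrite !hurwitz_moveL in E1.
have E2 := E (strandS i); rewrite !hurwitz_moveR E1 in E2.
move/elt_conj_inj: E2 => E2.
have [->//|n1] := eqVneq k (strand i); have [->//|n2] := eqVneq k (strandS i).
by have := E k; rewrite !hurwitz_move_other.
Qed.

Definition hurwitz_perm i : {perm d.-tuple elt} := perm (@hurwitz_move_inj i).

(* Multiplication in {perm _} is composition from left to right, so this is a
   right action of the braid group. *)
Definition hurwitz : braid_group d -> {perm d.-tuple elt} :=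
  pres_lift hurwitz_perm.

Definition braid_orbit (v w : d.-tuple elt) : Prop :=
  exists b : braid_group d, w = hurwitz b v.

Lemma hurwitz_perm_rel r s :
  braid_rel r s -> gword_eval hurwitz_perm r = gword_eval hurwitz_perm s.
Proof.
rewrite /gword_eval; case=> i j ij; rewrite !(big_cons, big_nil) /= !mulg1;
  apply/permP=> v; rewrite !permM !permE; apply: eq_from_tnth => k.
  have nN (m n : nat) : m < n -> (m != n) * (n != m).
    by move=> mn; rewrite !neq_ltn mn orbT.
  have ij' : i < j := ltnW ij.
  have n1 : (strand i != strand j) * (strand j != strand i).
    by rewrite -!val_eqE /=; apply: nN.
  have n2 : (strand i != strandS j) * (strandS j != strand i).
    by rewrite -!val_eqE /=; apply/nN/ltnW.
  have n3 : (strandS i != strand j) * (strand j != strandS i).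
    by rewrite -!val_eqE /=; apply: nN.
  have n4 : (strandS i != strandS j) * (strandS j != strandS i).
    by rewrite -!val_eqE /=; apply: nN.
  have hE := (hurwitz_moveL, hurwitz_moveR, hurwitz_move_other, n1, n2, n3, n4).
  have [->|k1] := eqVneq k (strand i); first by rewrite !hE.
  have [->|k2] := eqVneq k (strandS i); first by rewrite !hE.
  have [->|k3] := eqVneq k (strand j); first by rewrite !hE.
  have [->|k4] := eqVneq k (strandS j); first by rewrite !hE.
  by rewrite !hurwitz_move_other.
have eL : strandS i = strand j by apply: val_inj.
have n1 : (strand i != strand j) * (strand j != strand i).
  by rewrite -eL strand_neq eq_sym strand_neq.
have n2 : (strandS j != strand j) * (strand j != strandS j).
  by rewrite strand_neq eq_sym strand_neq.
have n3 : (strandS j != strand i) * (strand i != strandS j).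
  by rewrite -!val_eqE /= -ij !neq_ltn leqnSn !orbT.
have hR w : tnth (hurwitz_move i w) (strand j)
            = elt_conj (tnth w (strand i)) (tnth w (strand j)).
  by rewrite -eL hurwitz_moveR.
have hO w l : l != strand i -> l != strand j ->
    tnth (hurwitz_move i w) l = tnth w l.
  by move=> l1 l2; apply: hurwitz_move_other; rewrite ?eL.
have hL w : tnth (hurwitz_move i w) (strand i) = tnth w (strand j).
  by rewrite hurwitz_moveL eL.
have hLj := @hurwitz_moveL j; have hRj := @hurwitz_moveR j.
have hOj := @hurwitz_move_other j.
have [->|k1] := eqVneq k (strand i).
  by rewrite !(hL, hLj, hOj) ?n1 ?n3 // hO ?n3 ?n2 // hL.
have [->|k2] := eqVneq k (strand j).
  rewrite hR (hOj _ (strand i)) ?n1 ?n3 // hL hLj hO ?n2 ?n3 //.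
  by rewrite hLj hO ?n2 ?n3 // hRj.
have [->|k3] := eqVneq k (strandS j).
  rewrite hO ?n2 ?n3 // hRj hR hO ?n2 ?n3 //.
  rewrite hRj hR hO ?n2 ?n3 // hOj ?n1 ?n3 // hLj hRj.
  by rewrite elt_conjJ.
by rewrite !(hO, hOj).
Qed.

Lemma hurwitzM : {morph hurwitz : b c / b * c}.
Proof. exact: (pres_liftM hurwitz_perm_rel). Qed.

Lemma hurwitz_class w :
  hurwitz (pres_class (@braid_rel d) w) = gword_eval hurwitz_perm w.
Proof. exact: (pres_lift_class hurwitz_perm_rel). Qed.

Lemma hurwitz1 : hurwitz 1 = 1.
Proof. by rewrite -[1 in LHS]/(pres_class _ [::]) hurwitz_class /gword_eval big_nil. Qed.

Lemma hurwitz_gen i : hurwitz (braid_gen i) = hurwitz_perm i.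
Proof. exact: (pres_lift_gen hurwitz_perm_rel). Qed.

End Action.

(* Sequences over Gamma of arbitrary length are the disjoint union of the
   Gamma^d; v and w are braid equivalent when they have the same length d and
   lie in the same orbit of Br_d. *)
Definition braid_equiv (v w : seq elt) : Prop :=
  exists d (tv tw : d.-tuple elt),
    [/\ v = tv, w = tw & braid_orbit tv tw].

Inductive hurwitz_chain : seq elt -> seq elt -> Prop :=
| chain_refl v : hurwitz_chain v v
| chain_sym v w : hurwitz_chain v w -> hurwitz_chain w v
| chain_trans v w x : hurwitz_chain v w -> hurwitz_chain w x -> hurwitz_chain v x
| chain_move s t a b :
    hurwitz_chain (s ++ [:: a; b] ++ t) (s ++ [:: b; elt_conj a b] ++ t).

Lemma hurwitz_chain_move d (i : 'I_d.-1) (v : d.-tuple elt) :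
  hurwitz_chain v (hurwitz_move i v).
Proof.
have sv := size_tuple v; have i1 := strand_lt i.
pose a := tnth v (strand i); pose b := tnth v (strandS i).
pose s := take i v; pose t := drop i.+2 v.
have ev : (v : seq elt) = s ++ [:: a; b] ++ t.
  have i0 : i < d := ltnW i1.
  rewrite -[LHS](cat_take_drop i) (drop_nth a) ?sv // (drop_nth a) ?sv //.
  by congr (_ ++ [:: _, _ & _]); rewrite [RHS](tnth_nth a).
have ss : size s = i by rewrite size_takel // sv; do 2!apply: ltnW.
suff -> : (hurwitz_move i v : seq elt) = s ++ [:: b; elt_conj a b] ++ t.
  by rewrite ev; apply: chain_move.
apply: (@eq_from_nth _ a) => [|k].
  by rewrite size_tuple -{1}sv ev !size_cat.
rewrite size_tuple => kd; rewrite -(tnth_nth a _ (Ordinal kd)) tnth_mktuple.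
rewrite -!val_eqE /= -/a -/b (tnth_nth a) /= [in nth a v]ev !nth_cat ss.
have [->|ki] := eqVneq k i; first by rewrite ltnn subnn.
have [->|ki1] := eqVneq k i.+1; first by rewrite ltnNge leqnSn /= subSnn.
case: ltnP => // ik; have {}ik : i < k by rewrite ltn_neqAle eq_sym ki.
have {}ik : i.+1 < k by rewrite ltn_neqAle eq_sym ki1.
by rewrite -(subnKC ik) !addSn -!addnS addKn /= subn2.
Qed.

Lemma move_chain_orbit d (v : d.-tuple elt) b : hurwitz_chain v (hurwitz b v).
Proof.
rewrite -(pres_reprK b) hurwitz_class.
elim: (pres_repr b) v => [|[i c] w IHw] v.
  by rewrite /gword_eval big_nil perm1; apply: chain_refl.
rewrite /gword_eval big_cons permM; apply: chain_trans (IHw _) => /=.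
case: c; last by rewrite permE; apply: hurwitz_chain_move.
have := hurwitz_chain_move i ((hurwitz_perm i)^-1 v).
rewrite -[hurwitz_move _ _](permE (@hurwitz_move_inj d i)) permKV.
exact: chain_sym.
Qed.

Lemma braid_equivP v w : braid_equiv v w <-> hurwitz_chain v w.
Proof.
split=> [[d [tv [tw [-> -> [b ->]]]]]|]; first exact: move_chain_orbit.
elim=> {v w} [v|v w _|v w x _ + _|s t a b].
- exists (size v), (in_tuple v), (in_tuple v); split=> //; exists 1.
  by rewrite hurwitz1 perm1.
- case=> d [tv [tw [-> -> [b ->]]]]; exists d, (hurwitz b tv), tv; split=> //.
  exists b^-1; rewrite -permM -hurwitzM mulgV.
  by rewrite hurwitz1 perm1.
- case=> d [tv [tw [-> -> [b E]]]] [d' [tw' [tx [E' -> [b' ->]]]]].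
  have ed : d = d' by rewrite -(size_tuple tw) E' size_tuple.
  subst d'; have {}E' : tw' = tw by apply: val_inj.
  exists d, tv, (hurwitz b' tw'); split=> //.
  by exists (b * b'); rewrite E' E hurwitzM permM.
set v := s ++ _; have sd : size s < (size v).-1.
  by rewrite /v size_cat /= !addnS /= ltnS leq_addr.
pose i := Ordinal sd; exists (size v), (in_tuple v), (hurwitz_move i (in_tuple v)).
split=> //; last by exists (braid_gen i); rewrite hurwitz_gen permE.
apply: (@eq_from_nth _ a) => [|k].
  by rewrite size_tuple /v !size_cat.
have -> : size (s ++ [:: b; elt_conj a b] ++ t) = size v by rewrite /v !size_cat.
have nL : ((size s).+1 < size s) = false by rewrite ltnNge leqnSn.
move=> kd; rewrite -(tnth_nth a (hurwitz_move _ _) (Ordinal kd)) tnth_mktuple.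
rewrite -!val_eqE /= !(tnth_nth a) /= /v !nth_cat ltnn subnn nL subSnn /=.
have [->|ki] := eqVneq k (size s); first by rewrite ltnn subnn.
have [->|ki1] := eqVneq k (size s).+1; first by rewrite nL subSnn.
case: ltnP => // ik; have {}ik : size s < k by rewrite ltn_neqAle eq_sym ki.
have {}ik : (size s).+1 < k by rewrite ltn_neqAle eq_sym ki1.
by rewrite -(subnKC ik) !addSn -!addnS addKn /= subn2.
Qed.

Lemma chain_catl z v w : hurwitz_chain v w -> hurwitz_chain (z ++ v) (z ++ w).
Proof.
elim=> {v w} [v|v w _|v w x _ h1 _|s t a b].
- exact: chain_refl.
- exact: chain_sym.
- exact: chain_trans.
- by rewrite !(catA z); apply: chain_move.
Qed.

Lemma chain_catr z v w : hurwitz_chain v w -> hurwitz_chain (v ++ z) (w ++ z).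
Proof.
elim=> {v w} [v|v w _|v w x _ h1 _|s t a b].
- exact: chain_refl.
- exact: chain_sym.
- exact: chain_trans.
- by rewrite -!catA; apply: chain_move.
Qed.

Definition braid_eq (v w : seq elt) : bool := `[< braid_equiv v w >].

Lemma braid_eqP v w : reflect (hurwitz_chain v w) (braid_eq v w).
Proof. by apply: (iffP (asboolP _)) => /braid_equivP. Qed.

Lemma braid_eq_refl : reflexive braid_eq.
Proof. by move=> v; apply/braid_eqP; apply: chain_refl. Qed.
Lemma braid_eq_sym : symmetric braid_eq.
Proof. by move=> v w; apply/braid_eqP/braid_eqP; apply: chain_sym. Qed.
Lemma braid_eq_trans : transitive braid_eq.
Proof.
by move=> w v x /braid_eqP h1 /braid_eqP h2; apply/braid_eqP/(chain_trans h1 h2).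
Qed.

Canonical braid_equiv_rel :=
  EquivRel braid_eq braid_eq_refl braid_eq_sym braid_eq_trans.

Definition hurwitz_monoid := {eq_quot braid_equiv_rel}.
HB.instance Definition _ := Choice.on hurwitz_monoid.

Definition hclass (v : seq elt) : hurwitz_monoid :=
  \pi_({eq_quot braid_equiv_rel}) v.
Definition hrepr (x : hurwitz_monoid) : seq elt :=
  generic_quotient.repr (x : {eq_quot braid_equiv_rel}).

Lemma hclassP v w : hclass v = hclass w <-> braid_equiv v w.
Proof. by split=> [/eqmodP/asboolP | h]; last by apply/eqmodP/asboolP. Qed.

Lemma hreprK : cancel hrepr hclass.
Proof. by move=> x; rewrite /hclass reprK. Qed.

Lemma hreprP v : hurwitz_chain (hrepr (hclass v)) v.
Proof. by apply/braid_equivP/hclassP; rewrite hreprK. Qed.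

Definition hmul x y := hclass (hrepr x ++ hrepr y).

Lemma hmulE v w : hmul (hclass v) (hclass w) = hclass (v ++ w).
Proof.
apply/hclassP/braid_equivP; apply: (@chain_trans _ (v ++ hrepr (hclass w))).
  exact/chain_catr/hreprP.
exact/chain_catl/hreprP.
Qed.

Lemma hmulA : associative hmul.
Proof.
move=> x y z; rewrite -(hreprK x) -(hreprK y) -(hreprK z).
by rewrite !hmulE catA.
Qed.
Lemma hmul1 : left_id (hclass [::]) hmul.
Proof. by move=> x; rewrite -(hreprK x) hmulE. Qed.
Lemma hmulr1 : right_id (hclass [::]) hmul.
Proof. by move=> x; rewrite -(hreprK x) hmulE cats0. Qed.

HB.instance Definition _ := isMonoid.Build hurwitz_monoid hmulA hmul1 hmulr1.

Lemma hclassM v w : hclass (v ++ w) = hclass v * hclass w.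
Proof. by rewrite -hmulE. Qed.

Definition ev (x : hurwitz_monoid) : G := \prod_(g <- hrepr x) val g.

Lemma chain_prod v w :
  hurwitz_chain v w -> \prod_(g <- v) val g = \prod_(g <- w) val g.
Proof.
elim=> {v w} [v|v w _|v w x _ -> _|s t a b] //.
rewrite !big_cat /= !big_cons !big_nil !mulg1 /=.
by congr (_ * (_ * _)); rewrite -conjgC.
Qed.

Lemma ev_class v : ev (hclass v) = \prod_(g <- v) val g.
Proof. exact/chain_prod/hreprP. Qed.

Lemma evM : {morph ev : x y / x * y}.
Proof.
move=> x y; rewrite -(hreprK x) -(hreprK y) -hclassM !ev_class.
by rewrite big_cat.
Qed.

Lemma ev1 : ev 1 = 1.
Proof. by rewrite -[1]/(hclass [::]) ev_class big_nil. Qed.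

Lemma evX x n : ev (x ^+ n) = ev x ^+ n.
Proof. by elim: n => [|n IHn]; rewrite ?ev1 // !expgS evM IHn. Qed.

Lemma chain_pass a v b :
  val b = val a ^ (\prod_(g <- v) val g) -> hurwitz_chain (a :: v) (v ++ [:: b]).
Proof.
elim: v a => [|c v IHv] a.
  by rewrite big_nil conjg1 => /val_inj ->; apply: chain_refl.
rewrite big_cons conjgM => hb.
apply: chain_trans (chain_move [::] v a c) _.
exact/(@chain_catl [:: c])/IHv.
Qed.

Lemma ev1_central (u x : hurwitz_monoid) : ev u = 1 -> u * x = x * u.
Proof.
rewrite -(hreprK u) -(hreprK x) ev_class => hu.
rewrite -!hclassM; apply/hclassP/braid_equivP.
elim: (hrepr x) => [|a v IHv]; first by rewrite cats0; apply: chain_refl.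
rewrite -cat1s catA.
have h : hurwitz_chain (hrepr u ++ [:: a]) (a :: hrepr u).
  by apply/chain_sym/chain_pass; rewrite hu conjg1.
apply: chain_trans (chain_catr v h) _.
exact: (@chain_catl [:: a]).
Qed.

Definition stably_equivalent (u x y : hurwitz_monoid) : Prop :=
  exists k, x * u ^+ k = y * u ^+ k.

Inductive adj_rel : gword elt -> gword elt -> Prop :=
| adj_rel_conj a b :
    adj_rel [:: (a, false); (b, false)] [:: (b, false); (elt_conj a b, false)].

Definition Adj := presented_group adj_rel.
HB.instance Definition _ := Group.on Adj.

Definition adj_gen (a : elt) : Adj := pres_gen adj_rel a.

End Hurwitz.

Record central_submonoid (M : monoidType) := CentralSubmonoid {
  csub :> {pred M};
  csub_closed : monoid_closed csub;
  csub_central : {in csub, forall s x, s * x = x * s}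
}.

Section Fractions.
Variables (M : monoidType) (S : central_submonoid M).

Let pair := (M * {s : M | s \in csub S})%type.

(* p = (x, s) stands for x / s. *)
Definition frac_equiv (p q : pair) : Prop :=
  exists (r : M) (s : {s : M | s \in csub S}),
    p.1 * r = q.1 * val s /\ val p.2 * r = val q.2 * val s.

Definition csub_mul (s t : {s : M | s \in csub S}) : {s : M | s \in csub S} :=
  exist _ (val s * val t) ((csub_closed S).2 _ _ (valP s) (valP t)).

Definition csub_one : {s : M | s \in csub S} := exist _ 1 (csub_closed S).1.

Lemma csubC (s : {s : M | s \in csub S}) x : val s * x = x * val s.
Proof. exact: (csub_central (valP s)). Qed.

Definition frac_eq (p q : pair) : bool := `[< frac_equiv p q >].

Lemma frac_eq_refl : reflexive frac_eq.
Proof. by move=> p; apply/asboolP; exists 1, csub_one. Qed.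

Lemma frac_equiv_sym p q : frac_equiv p q -> frac_equiv q p.
Proof.
case: p q => [x s] [y t] [r [a /= [h1 h2]]].
exists (val a * val s), (csub_mul t a) => /=; split.
  by rewrite mulgA -h1 -mulgA -csubC h2.
by rewrite !mulgA -csubC mulgA.
Qed.

Lemma frac_eq_sym : symmetric frac_eq.
Proof. by move=> p q; apply/asboolP/asboolP; apply: frac_equiv_sym. Qed.

Lemma frac_eq_trans : transitive frac_eq.
Proof.
move=> [y t] [x s] [z w] /asboolP[r [a /= [h1 h2]]] /asboolP[r' [a' /= [h3 h4]]].
apply/asboolP; exists (r * r'), (csub_mul a' a) => /=; split.
  by rewrite mulgA h1 -mulgA (csubC a) mulgA h3 mulgA.
by rewrite mulgA h2 -mulgA (csubC a) mulgA h4 mulgA.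
Qed.

Canonical frac_equiv_rel := EquivRel frac_eq frac_eq_refl frac_eq_sym frac_eq_trans.

Definition fractions := {eq_quot frac_equiv_rel}.
HB.instance Definition _ := Choice.on fractions.

Definition frac (p : pair) : fractions := \pi_({eq_quot frac_equiv_rel}) p.
Definition frac_repr (f : fractions) : pair :=
  generic_quotient.repr (f : {eq_quot frac_equiv_rel}).

Lemma fracP p q : frac p = frac q <-> frac_equiv p q.
Proof. by split=> [/eqmodP/asboolP | h]; last by apply/eqmodP/asboolP. Qed.

Lemma frac_reprK : cancel frac_repr frac.
Proof. by move=> f; rewrite /frac reprK. Qed.

Definition pair_mul (p q : pair) : pair := (p.1 * q.1, csub_mul p.2 q.2).

Definition frac_mul f g := frac (pair_mul (frac_repr f) (frac_repr g)).

Lemma pair_mul_equivl p q q' :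
  frac_equiv q q' -> frac_equiv (pair_mul p q) (pair_mul p q').
Proof.
case: p q q' => [x s] [y t] [z w] [r [a /= [h1 h2]]].
by exists r, a => /=; rewrite -!mulgA h1 h2.
Qed.

Lemma pair_mul_equivr p p' q :
  frac_equiv p p' -> frac_equiv (pair_mul p q) (pair_mul p' q).
Proof.
case: p p' q => [x s] [y t] [z w] [r [a /= [h1 h2]]].
have h : x * (val t * val a) = y * (val s * val a).
  by rewrite -h2 (csubC s r) mulgA h1 -mulgA (csubC s).
exists (val t * val a), (csub_mul s a) => /=; split.
  rewrite -mulgA -(csubC (csub_mul t a)) /= mulgA h.
  by rewrite -mulgA (csubC (csub_mul s a)) mulgA.
rewrite -!mulgA -!(csubC (csub_mul _ a)) /= !mulgA.
by rewrite (csubC s (val t)).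
Qed.

Lemma frac_mulE p q : frac_mul (frac p) (frac q) = frac (pair_mul p q).
Proof.
have hr p' : frac_equiv (frac_repr (frac p')) p' by apply/fracP; rewrite frac_reprK.
apply/fracP/fracP; transitivity (frac (pair_mul p (frac_repr (frac q)))).
  exact/fracP/pair_mul_equivr.
exact/fracP/pair_mul_equivl.
Qed.

Lemma frac_mulA : associative frac_mul.
Proof.
move=> f g h; rewrite -(frac_reprK f) -(frac_reprK g) -(frac_reprK h) !frac_mulE.
by rewrite /pair_mul /= mulgA; congr (frac (_, _)); apply: val_inj; rewrite /= mulgA.
Qed.
Lemma frac_mul1 : left_id (frac (1, csub_one)) frac_mul.
Proof.
move=> f; rewrite -(frac_reprK f) frac_mulE /pair_mul /= mul1g.
by case: (frac_repr f) => x s; congr (frac (_, _)); apply: val_inj; rewrite /= mul1g.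
Qed.
Lemma frac_mulr1 : right_id (frac (1, csub_one)) frac_mul.
Proof.
move=> f; rewrite -(frac_reprK f) frac_mulE /pair_mul /= mulg1.
by case: (frac_repr f) => x s; congr (frac (_, _)); apply: val_inj; rewrite /= mulg1.
Qed.

HB.instance Definition _ := isMonoid.Build fractions frac_mulA frac_mul1 frac_mulr1.

End Fractions.

Definition is_group (M : monoidType) : Prop :=
  forall x : M, exists y : M, y * x = 1 /\ x * y = 1.

Section PeriodPowers.
Variables (G : finGroupType) (Gamma : {set G}) (hGamma : is_class_union Gamma).
Variables (u : hurwitz_monoid hGamma) (ell : nat).
Hypothesis ev_order : #[ev u] = ell.

Definition period_pred : {pred hurwitz_monoid hGamma} :=
  [pred x | `[< exists n, x = u ^+ (n * ell)%N >]].

Lemma period_pred_closed : monoid_closed period_pred.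
Proof.
split; first by apply/asboolP; exists 0%N.
move=> _ _ /asboolP[m ->] /asboolP[n ->]; apply/asboolP; exists (m + n)%N.
by rewrite mulnDl expgnDr.
Qed.

Lemma period_pred_central : {in period_pred, forall s x, s * x = x * s}.
Proof.
move=> _ /asboolP[n ->] x; apply: ev1_central.
by rewrite evX -ev_order mulnC expgM expg_order expg1n.
Qed.

Definition period_powers : central_submonoid (hurwitz_monoid hGamma) :=
  CentralSubmonoid period_pred_closed period_pred_central.

End PeriodPowers.

(* Main.v *)
Require Import Defs.
From HB Require Import structures.
From mathcomp Require Import all_boot all_fingroup.
From mathcomp Require Import boolp.

Local Open Scope group_scope.

(** Evaluating tuples in [Adj Gamma] is invariant under Hurwitz moves and its
    target is a group, so a stabilizing power of [u] can be cancelled.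
    Conversely, Hurwitz moves give the generators [[g / 1]] of the group of
    fractions the defining relations of [Adj Gamma], so [e_g] maps to
    [[g / 1]]; and [[v / 1]] = [[w / 1]] means exactly that [v s] = [w s] for
    some [s], which is a power of [u]. *)

(* The unused argument [hM] keys the canonical group structure on the copy of [M]. *)
Definition unit_monoid (M : monoidType) (hM : is_group M) : Type := M.

Section UnitMonoid.
Variables (M : monoidType) (hM : is_group M).

HB.instance Definition _ := Monoid.copy (unit_monoid M hM) M.

(** [is_group] only asserts that inverses exist, so [cid] picks one. *)
Definition unit_inv (x : unit_monoid M hM) : unit_monoid M hM :=
  sval (cid (hM x)).

Lemma unit_mulVl : left_inverse 1 unit_inv *%g.
Proof. by move=> x; case: (svalP (cid (hM x))). Qed.

Lemma unit_mulV : right_inverse 1 unit_inv *%g.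
Proof. by move=> x; case: (svalP (cid (hM x))). Qed.

HB.instance Definition _ := hasInv.Build (unit_monoid M hM) unit_inv.
HB.instance Definition _ :=
  Monoid_isGroup.Build (unit_monoid M hM) unit_mulVl unit_mulV.

End UnitMonoid.

Section Evaluation.
Variables (G : finGroupType) (Gamma : {set G}) (hGamma : is_class_union Gamma).
Local Notation elt := (elt Gamma).
Local Notation H := (hurwitz_monoid hGamma).

Lemma hclass_prod (v : seq elt) :
  hclass hGamma v = \prod_(a <- v) hclass hGamma [:: a].
Proof.
elim: v => [|a v IHv]; first by rewrite big_nil.
by rewrite big_cons -IHv -hclassM.
Qed.

Lemma hclass_conj (a b : elt) :
  hclass hGamma [:: a] * hclass hGamma [:: b] =
  hclass hGamma [:: b] * hclass hGamma [:: elt_conj hGamma a b].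
Proof.
rewrite -!hclassM; apply/hclassP/braid_equivP.
exact: (chain_move hGamma [::] [::]).
Qed.

Lemma adj_gen_conj (a b : elt) :
  adj_gen hGamma a * adj_gen hGamma b =
  adj_gen hGamma b * adj_gen hGamma (elt_conj hGamma a b).
Proof.
rewrite /adj_gen /pres_gen -!pres_classM; apply/pres_classP.
exact: (@pres_rel _ _ [::] [::] _ _ (adj_rel_conj hGamma a b)).
Qed.

(** Computed on a chosen representative; [adj_eval_class] shows that the choice does not matter. *)
Definition adj_eval (x : H) : Adj hGamma := \prod_(a <- hrepr x) adj_gen hGamma a.

Lemma chain_adj_prod (v w : seq elt) :
  hurwitz_chain hGamma v w ->
  \prod_(a <- v) adj_gen hGamma a = \prod_(a <- w) adj_gen hGamma a.
Proof.
elim=> {v w} [v|v w _|v w x _ -> _|s t a b] //.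
by rewrite !big_cat /= !big_cons !big_nil !mulg1 adj_gen_conj.
Qed.

Lemma adj_eval_class v :
  adj_eval (hclass hGamma v) = \prod_(a <- v) adj_gen hGamma a.
Proof. exact/chain_adj_prod/hreprP. Qed.

Lemma adj_evalM : {morph adj_eval : x y / x * y}.
Proof.
move=> x y; rewrite -(hreprK x) -(hreprK y) -hclassM !adj_eval_class.
by rewrite big_cat.
Qed.

Lemma stably_equivalent_adj_eval (u x y : H) :
  stably_equivalent u x y -> adj_eval x = adj_eval y.
Proof. by case=> k /(congr1 adj_eval); rewrite !adj_evalM => /mulIg. Qed.

End Evaluation.

Section FractionMap.
Variables (M : monoidType) (S : central_submonoid M).

Definition frac_of (x : M) : fractions S := frac (x, csub_one S).

Lemma frac_ofM : {morph frac_of : x y / x * y}.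
Proof.
move=> x y; rewrite /frac_of [RHS]frac_mulE; congr (frac (_, _)).
by apply: val_inj; rewrite /= mulg1.
Qed.

Lemma frac_of_prod (I : Type) (r : seq I) (F : I -> M) :
  frac_of (\prod_(i <- r) F i) = \prod_(i <- r) frac_of (F i).
Proof. exact: (big_morph frac_of frac_ofM). Qed.

(** Both denominators are 1, so the second equation of [frac_equiv] forces the two multipliers to
    coincide, and the common one lies in [S]. *)
Lemma frac_of_eqP x y :
  frac_of x = frac_of y <-> exists2 s, s \in csub S & x * s = y * s.
Proof.
split=> [/fracP[r [[s Ss] /= []]] | [s Ss xsys]].
  by rewrite !mul1g => xrys rs; exists s; rewrite // -{1}rs.
by apply/fracP; exists s, (exist _ s Ss).
Qed.

End FractionMap.

(** Universal property of [Adj]: [f] respects the conjugation relations, so it extends to a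
    homomorphism, which is applied to both sides. *)
Lemma adj_prod_eq_lift (G : finGroupType) (Gamma : {set G})
    (hGamma : is_class_union Gamma) (K : groupType) (f : elt Gamma -> K) :
    (forall a b, f a * f b = f b * f (elt_conj hGamma a b)) ->
  forall v w : seq (elt Gamma),
    \prod_(a <- v) adj_gen hGamma a = \prod_(a <- w) adj_gen hGamma a ->
  \prod_(a <- v) f a = \prod_(a <- w) f a.
Proof.
move=> fJ v w.
have fR r s : adj_rel hGamma r s -> gword_eval f r = gword_eval f s.
  by case=> a b; rewrite /gword_eval !big_cons big_nil /= !mulg1.
have liftE x : pres_lift f (\prod_(a <- x) adj_gen hGamma a) = \prod_(a <- x) f a.
  elim: x => [|a x IHx].
    by rewrite !big_nil (pres_lift_class fR [::]) /gword_eval big_nil.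
  by rewrite !big_cons (pres_liftM fR) IHx (pres_lift_gen fR).
by move=> /(congr1 (pres_lift f)); rewrite !liftE.
Qed.

Theorem proposition3p8
  (G : finGroupType) (Gamma : {set G}) (hGamma : is_class_union Gamma)
  (u : hurwitz_monoid hGamma) (ell : nat) (hell : #[ev u] = ell)
  (hfrac : is_group (fractions (period_powers hell)))
  (d : nat) (v w : d.-tuple (elt Gamma)) :
  stably_equivalent u (hclass hGamma v) (hclass hGamma w) <->
  \prod_(i < d) adj_gen hGamma (tnth v i)
    = \prod_(i < d) adj_gen hGamma (tnth w i).
Proof.
rewrite -!(big_tuple _ _ _ xpredT (adj_gen hGamma)); split.
  by move/stably_equivalent_adj_eval; rewrite !adj_eval_class.
(* The target is typed as [unit_monoid] because lifting from [Adj] needs a [groupType]; its product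
   is still that of the fractions. *)
pose f a : unit_monoid _ hfrac := frac_of _ (period_powers hell) (hclass hGamma [:: a]).
have fJ a b : f a * f b = f b * f (elt_conj hGamma a b).
  transitivity (frac_of _ (period_powers hell)
    (hclass hGamma [:: a] * hclass hGamma [:: b])); first by rewrite frac_ofM.
  by rewrite hclass_conj frac_ofM.
move=> /(adj_prod_eq_lift _ _ _ _ f fJ) fvw.
have: frac_of _ (period_powers hell) (hclass hGamma v)
    = frac_of _ (period_powers hell) (hclass hGamma w).
  by rewrite (hclass_prod _ _ _ v) (hclass_prod _ _ _ w) !frac_of_prod.
(* The common multiplier lies in [period_powers], hence is [u ^+ (n * ell)], which gives the
   stabilizing exponent. *)
by case/frac_of_eqP=> _ /asboolP[n ->] vw; exists (n * ell)%N.
Qed.
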